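(* Let $\sigma\ge 1$ and $n\ge 1$ be integers and let $\Sigma$ be a totally ordered alphabet of size $\sigma$. Let $M(\sigma,n)$ be the total number of occurrences of Lyndon factors (counted according to multiplicity) in all $\sigma^n$ words of length $n$ over $\Sigma$, that is, the number of triples $(w,i,m)$ where $w=x_1x_2\cdots x_n\in\Sigma^n$, $1\le m\le n$, $1\le i\le n-m+1$, and $x_i x_{i+1}\cdots x_{i+m-1}$ is a Lyndon word. Then $$M(\sigma,n)=\sum_{m=1}^{n}\frac{n-m+1}{m}\,\sigma^{n-m}\sum_{d\mid m}\mu\!\left(\frac{m}{d}\right)\sigma^{d},$$ and the expected total number $ET(\sigma,n)$ of Lyndon factors (counted with multiplicity) in a uniformly random word of length $n$ over $\Sigma$ is $ET(\sigma,n)=M(\sigma,n)/\sigma^n$.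
   Context: $\mu$ denotes the M\''obius function. $\Sigma^n$ is the set of words of length $n$ over $\Sigma$; words are compared by the lexicographic order induced by the order on $\Sigma$. A word is primitive if it is non-empty and is not a power $x^k$, $k\ge 2$, of a shorter word $x$. Two words $u,v$ are conjugate if $u=xy$ and $v=yx$ for some words $x,y$. A Lyndon word is a non-empty primitive word that is lexicographically least in its conjugacy class (equivalently, a non-empty word that is a single letter or is strictly smaller than each of its non-empty proper suffixes). *)

(* Defs.v *)
From HB Require Import structures.
From mathcomp Require Import all_boot all_order all_algebra.
From mathcomp Require Import boolp.

Set Implicit Arguments.
Unset Strict Implicit.
Unset Printing Implicit Defensive.

Import Order.TTheory GRing.Theory Num.Theory.
Local Open Scope ring_scope.

(* The value at 0 is a junk value. *)
Definition moebius (n : nat) : int :=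
  if (0 < n)%N && ~~ has (fun p => p ^ 2 %| n)%N (primes n)
  then (-1) ^+ size (primes n) else 0.

Definition word_pow (T : Type) (x : seq T) (k : nat) : seq T :=
  flatten (nseq k x).

Definition primitive_word (T : Type) (w : seq T) : Prop :=
  w <> [::] /\
  ~ (exists (x : seq T) (k : nat),
       [/\ (2 <= k)%N, (size x < size w)%N & w = word_pow x k]).

Definition conjugate_words (T : Type) (u v : seq T) : Prop :=
  exists x y : seq T, u = x ++ y /\ v = y ++ x.

(* [seqlexi T] is [seq T] equipped with the lexicographic order. *)
Definition lyndon (disp : Order.disp_t) (T : orderType disp) (w : seq T) :
    Prop :=
  primitive_word w /\
  forall v : seq T, conjugate_words w v ->
    ((w : seqlexi T) <= (v : seqlexi T))%O.

(* The length-m factor of w starting at the i-th letter, with i >= 1. *)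
Definition factor (T : Type) (w : seq T) (i m : nat) : seq T :=
  take m (drop i.-1 w).

(* (i, m) is the position and length of an occurrence of a Lyndon factor. *)
Definition lyndon_occ (disp : Order.disp_t) (T : orderType disp)
    (w : seq T) (i m : nat) : Prop :=
  [/\ (1 <= m <= size w)%N, (1 <= i <= size w - m + 1)%N
    & lyndon (factor w i m)].

(* The quantity M(#|T|, n); the bounds in [lyndon_occ] force i, m <= n, so that
   ranging over 'I_n.+1 loses no triple. *)
Definition total_lyndon_factors (disp : Order.disp_t) (T : finOrderType disp)
    (n : nat) : nat :=
  #|[set t : n.-tuple T * 'I_n.+1 * 'I_n.+1 |
       `[< lyndon_occ t.1.1 t.1.2 t.2 >]]|.

Definition num_lyndon_factors (disp : Order.disp_t) (T : finOrderType disp)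
    (n : nat) (w : n.-tuple T) : nat :=
  #|[set p : 'I_n.+1 * 'I_n.+1 | `[< lyndon_occ w p.1 p.2 >]]|.

Definition uniform_expectation (W : finType) (X : W -> rat) : rat :=
  \sum_(w : W) (#|W|%:R)^-1 * X w.

(* The quantity ET(#|T|, n). *)
Definition expected_lyndon_factors (disp : Order.disp_t)
    (T : finOrderType disp) (n : nat) : rat :=
  uniform_expectation (fun w : n.-tuple T => (num_lyndon_factors w)%:R).

(* Main.v *)
Require Import Defs.
From mathcomp Require Import boolp.
From mathcomp Require Import all_boot all_order all_algebra.
From mathcomp Require Import zify ring.

Set Implicit Arguments.
Unset Strict Implicit.
Unset Printing Implicit Defensive.

Import Order.TTheory GRing.Theory Num.Theory.
Local Open Scope ring_scope.

(** By linearity over the pairs (position, length), everything reduces to counting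
    Lyndon words of each length [m >= 1]: a factor of length [m] occupies one of
    [n - m + 1] positions, and the remaining [n - m] letters are free, so that
    the number of triples is the sum of [(n - m + 1) * sigma ^ (n - m) * L m],
    where [L m] is the number of Lyndon words of length [m]
    ([total_lyndon_factorsE]).

    To compute [L m], let the cyclic group generated by the rotation by one
    letter act on the words of length [m], and call the size of the orbit of [w]
    the period of [w].  A word is primitive exactly when its orbit has the
    maximal size [m] ([primitive_period]).  Each such orbit contains exactly one
    Lyndon word, its least element, so that [m * L m] is the number of primitive
    words ([card_lyndon]).

    Finally, for [d] dividing [m], the words whose period divides [d] are those
    fixed by the rotation by [d] letters.  They are the powers of the words of
    length [d], hence there are [sigma ^ d] of them ([card_period_dvd]).  In the
    sum of [moebius (m %/ d) * sigma ^ d] over the divisors [d] of [m], a word of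
    period [p] is therefore counted with the total weight of [moebius (m %/ d)]
    over the [d] between [p] and [m] for divisibility.  This weight is [1] if
    [p = m] and [0] otherwise ([sum_moebius_between]), so that the sum counts the
    primitive words ([card_primitive]).

    The expectation is this total divided by the number [sigma ^ n] of words. *)

(** * Sums of the Moebius function over divisors *)

Lemma moebius_mul_prime (p e : nat) :
  prime p -> ~~ (p %| e)%N -> moebius (p * e) = - moebius e.
Proof.
move=> p_pr pNe.
have e_gt0 : (0 < e)%N by case: e pNe => //; rewrite dvdn0.
have p_gt0 := prime_gt0 p_pr.
have prE : perm_eq (primes (p * e)) (p :: primes e).
  apply: uniq_perm; first exact: primes_uniq.
    by rewrite /= primes_uniq andbT mem_primes p_pr e_gt0.
  by move=> q; rewrite primesM // inE primes_prime // inE.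
rewrite /moebius muln_gt0 p_gt0 e_gt0 /= (perm_size prE) (perm_has _ prE) /=.
rewrite expnS expn1 dvdn_pmul2l // (negPf pNe) /=.
set b := has _ _; set c := has _ _.
have -> : b = c.
  apply: eq_in_has => q; rewrite mem_primes => /and3P[q_pr _ qe].
  rewrite Gauss_dvdr // coprimeXl // prime_coprime // dvdn_prime2 //.
  by apply: contraNneq pNe => <-.
by case: c => /=; rewrite ?oppr0 // exprS mulN1r.
Qed.

Lemma moebius_square_dvd (p d : nat) :
  prime p -> (p ^ 2 %| d)%N -> moebius d = 0.
Proof.
move=> p_pr pd; rewrite /moebius.
case: posnP => //= d_gt0; suff -> : has (fun q => q ^ 2 %| d)%N (primes d) by [].
apply/hasP; exists p => //.
by rewrite mem_primes p_pr d_gt0 (dvdn_trans _ pd) // dvdn_exp.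
Qed.

(** If [a > 1], pick a prime [p] dividing [a].  The divisors prime to [p] cancel
    against their multiples by [p], and the divisors that are multiples of
    [p ^ 2] contribute nothing. *)
Lemma sum_moebius_divisors (a : nat) :
  (0 < a)%N -> \sum_(d <- divisors a) moebius d = (a == 1)%:R.
Proof.
move=> a_gt0; case: eqP => [->|/eqP a_neq1].
  by rewrite (_ : divisors 1 = [:: 1%N]) // big_seq1.
have a_gt1 : (1 < a)%N by rewrite ltn_neqAle eq_sym a_neq1.
have [p p_pr pa] : exists2 p, prime p & (p %| a)%N.
  by exists (pdiv a); [exact: pdiv_prime | exact: pdiv_dvd].
have p_gt0 := prime_gt0 p_pr.
have ap_gt0 : (0 < a %/ p)%N by rewrite divn_gt0 // dvdn_leq.
rewrite (bigID (fun d => p %| d)%N) /= addrC; apply/eqP; rewrite addr_eq0.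
rewrite -sumrN -(big_filter _ (fun d => p %| d)%N).
have mulpE : perm_eq [seq d <- divisors a | (p %| d)%N]
                     [seq (p * e)%N | e <- divisors (a %/ p)].
  apply: uniq_perm; first by rewrite filter_uniq ?divisors_uniq.
    rewrite map_inj_uniq ?divisors_uniq // => x y /eqP.
    by rewrite eqn_pmul2l // => /eqP.
  move=> d; rewrite mem_filter -dvdn_divisors //; apply/andP/mapP.
    case=> /dvdnP[e ->] da; exists e; last by rewrite mulnC.
    by rewrite -dvdn_divisors // dvdn_divRL.
  case=> e; rewrite -dvdn_divisors // dvdn_divRL // => ea ->.
  by rewrite dvdn_mulr // mulnC.
rewrite (perm_big _ mulpE) big_map /=.
rewrite [X in _ == X](bigID (fun d => p %| d)%N) /= [X in _ == X + _]big1 ?add0r; last first.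
  move=> e pe; rewrite (@moebius_square_dvd p) ?oppr0 //.
  by rewrite expnS expn1 dvdn_pmul2l.
rewrite [X in _ == X](eq_bigr moebius); last first.
  by move=> e pNe; rewrite moebius_mul_prime // opprK.
rewrite -!(big_filter _ (fun d => ~~ (p %| d)%N)).
apply/eqP/perm_big/uniq_perm; rewrite ?filter_uniq ?divisors_uniq // => d.
rewrite !mem_filter -!dvdn_divisors //.
case: (boolP (p %| d)%N) => //= pNd; rewrite dvdn_divRL //.
by rewrite Gauss_dvd ?pa ?andbT // coprime_sym prime_coprime.
Qed.

(** The codivisors [m %/ d] of these [d] are the divisors of [m %/ p], so this is
    the previous sum; it is the cancellation behind Moebius inversion. *)
Lemma sum_moebius_between (m p : nat) : (0 < m)%N -> (p %| m)%N ->
  \sum_(d <- divisors m | (p %| d)%N) moebius (m %/ d) = (p == m)%:R.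
Proof.
move=> m_gt0 pm; have p_gt0 := dvdn_gt0 m_gt0 pm.
have mp_gt0 : (0 < m %/ p)%N by rewrite divn_gt0 // dvdn_leq.
rewrite -big_filter.
have codivE : perm_eq [seq d <- divisors m | (p %| d)%N]
                      [seq (m %/ e)%N | e <- divisors (m %/ p)].
  apply: uniq_perm; first by rewrite filter_uniq ?divisors_uniq.
    rewrite map_inj_in_uniq ?divisors_uniq // => x y.
    rewrite -!dvdn_divisors // => /dvdn_trans-/(_ m) xm /dvdn_trans-/(_ m) ym.
    move=> /(congr1 (divn m)).
    by rewrite !divnA ?xm ?ym ?dvdn_div // !mulKn.
  move=> d; rewrite mem_filter -dvdn_divisors //; apply/andP/mapP.
    case=> pd dm; exists (m %/ d)%N; last by rewrite divnA // mulKn.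
    rewrite -dvdn_divisors // dvdn_divRL //.
    case/dvdnP: dm m_gt0 => q ->; rewrite muln_gt0 => /andP[_ d_gt0].
    by rewrite mulnK // dvdn_mul.
  case=> e; rewrite -dvdn_divisors // dvdn_divRL // => epm ->.
  have em : (e %| m)%N by apply: dvdn_trans epm; rewrite dvdn_mulr.
  split; last by apply: dvdn_div.
  by rewrite dvdn_divRL // mulnC.
rewrite (perm_big _ codivE) big_map /= big_seq.
rewrite (eq_bigr moebius) => [|e]; last first.
  rewrite -dvdn_divisors // => /dvdn_trans-/(_ m) em.
  by rewrite divnA ?em ?dvdn_div // mulKn.
rewrite -big_seq sum_moebius_divisors //.
by rewrite -(eqn_pmul2r p_gt0) divnK // mul1n eq_sym.
Qed.

(** * Rotations, periods and primitive words *)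

Lemma iter_order_dvdn (X : finType) (f : X -> X) (x : X) (k : nat) :
  injective f -> (iter k f x == x) = (order f x %| k)%N.
Proof.
move=> f_inj; rewrite {1}(divn_eq k (order f x)) addnC iterD iterM.
rewrite [iter (k %/ _) _ x]iter_fix ?iter_order // /dvdn.
have lt_mod : (k %% order f x < order f x)%N by rewrite ltn_mod order_gt0.
apply/eqP/eqP => [eq_x|-> //].
by rewrite -(findex_iter lt_mod) eq_x findex0.
Qed.

Definition rot1_tuple (T : Type) (m : nat) (w : m.-tuple T) : m.-tuple T :=
  [tuple of rot 1 w].

Lemma rot1_tuple_inj (T : Type) (m : nat) : injective (@rot1_tuple T m).
Proof. by move=> u v /(congr1 val) /= /rot_inj; apply: val_inj. Qed.

Lemma iter_rot1_tuple (T : Type) (m k : nat) (w : m.-tuple T) :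
  (k <= m)%N -> iter k (@rot1_tuple T m) w = rot k w :> seq T.
Proof.
elim: k => [|k IHk] lt_km; first by rewrite rot0.
by rewrite rotS ?size_tuple //= IHk // ltnW.
Qed.

(** The size of the orbit under rotation, which is also the least
    positive [d] such that the rotation by [d] fixes the word. *)
Definition period (T : finType) (m : nat) (w : m.-tuple T) : nat :=
  order (@rot1_tuple T m) w.

Lemma rot_eq_period (T : finType) (m d : nat) (w : m.-tuple T) :
  (d <= m)%N -> (rot d w == w :> seq T) = (period w %| d)%N.
Proof.
move=> le_dm; rewrite -iter_order_dvdn; last exact: rot1_tuple_inj.
by rewrite -val_eqE /= iter_rot1_tuple.
Qed.

Lemma period_dvd (T : finType) (m : nat) (w : m.-tuple T) : (period w %| m)%N.
Proof. by rewrite -rot_eq_period // -{1}(size_tuple w) rot_size. Qed.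

Lemma word_powS (T : Type) (x : seq T) (k : nat) :
  word_pow x k.+1 = x ++ word_pow x k.
Proof. by []. Qed.

Lemma size_word_pow (T : Type) (x : seq T) (k : nat) :
  size (word_pow x k) = (k * size x)%N.
Proof. by elim: k => // k IHk; rewrite word_powS size_cat IHk mulSn. Qed.

Lemma rot_word_pow (T : Type) (x : seq T) (k : nat) :
  rot (size x) (word_pow x k) = word_pow x k.
Proof.
case: k => [|k]; first by rewrite rot_oversize.
rewrite word_powS rot_size_cat.
by elim: k => [|k IHk]; rewrite ?cats0 // word_powS -catA IHk.
Qed.

(** Commuting with [u] lets copies of [u] be peeled off the front of [v] one at a
    time, the rest of [v] still commuting with [u]. *)
Lemma commute_word_pow (T : eqType) (u v : seq T) (k : nat) :
  size v = (k * size u)%N -> v ++ u = u ++ v -> v = word_pow u k.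
Proof.
elim: k v => [v /size0nil //|k IHk v sz_v vu_uv].
have le_uv : (size u <= size v)%N by rewrite sz_v mulSn leq_addr.
have v_def : v = u ++ drop (size u) v.
  rewrite -{1}(cat_take_drop (size u) v); congr (_ ++ _).
  by rewrite -(takel_cat u le_uv) vu_uv take_size_cat.
rewrite v_def word_powS; congr (_ ++ _); apply: IHk.
  by rewrite size_drop sz_v mulSn addKn.
by move/eqP: vu_uv; rewrite {1 2}v_def -catA eqseq_cat // eqxx => /eqP.
Qed.

(** That [w = u ++ v] is fixed by the rotation by [size u] says that [u] and [v]
    commute. *)
Lemma rot_fixed_word_pow (T : eqType) (k d : nat) (w : seq T) :
  size w = (k * d)%N -> rot d w = w -> w = word_pow (take d w) k.
Proof.
case: k => [/size0nil -> //|k sz_w rot_w].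
have sz_take : size (take d w) = d by rewrite size_takel // sz_w leq_addr.
rewrite word_powS -{1}(cat_take_drop d w); congr (_ ++ _).
apply: commute_word_pow; last by rewrite cat_take_drop.
by rewrite size_drop sz_take sz_w mulSn addKn.
Qed.

(** A period [p < m] divides [m], so [w] is the power [m %/ p] of its prefix of
    length [p].  Conversely a power of [x] is fixed by the rotation by [size x],
    which must then be a multiple of the period. *)
Lemma primitive_period (T : finType) (m : nat) (w : m.-tuple T) :
  (0 < m)%N -> primitive_word w <-> period w = m.
Proof.
move=> m_gt0; have dvd_m := period_dvd w; split=> [[_ not_pow]|per_w].
  apply/eqP; case: eqVneq => // neq_m; case: not_pow.
  have lt_m : (period w < m)%N by rewrite ltn_neqAle neq_m dvdn_leq.
  exists (take (period w) w), (m %/ period w)%N; split.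
  - by rewrite ltn_divRL // mul1n.
  - by rewrite size_takel size_tuple // ltnW.
  - apply: rot_fixed_word_pow; first by rewrite size_tuple divnK.
    by apply/eqP; rewrite rot_eq_period // ltnW.
split=> [w0|[x [k [_ lt_xm w_def]]]].
  by rewrite -(size_tuple w) w0 in m_gt0.
rewrite size_tuple in lt_xm.
have : (period w %| size x)%N.
  by rewrite -rot_eq_period ?(ltnW lt_xm) // w_def rot_word_pow.
rewrite per_w; case: (posnP (size x)) => [/size0nil x0 _|x_gt0 /dvdn_leq].
  by move: m_gt0; rewrite -(size_tuple w) w_def size_word_pow x0 muln0.
by move=> /(_ x_gt0); rewrite leqNgt lt_xm.
Qed.

(** Taking powers is a bijection from the words of length [d] onto the words of
    length [m] fixed by the rotation by [d]. *)
Lemma card_period_dvd (T : finType) (m d : nat) :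
  (0 < m)%N -> (d %| m)%N ->
  #|[set w : m.-tuple T | (period w %| d)%N]| = (#|T| ^ d)%N.
Proof.
move=> m_gt0 /dvdnP[k m_def]; subst m.
have [k_gt0 d_gt0] : (0 < k)%N /\ (0 < d)%N.
  by apply/andP; rewrite -muln_gt0.
have le_dm : (d <= k * d)%N by rewrite leq_pmull.
have pow_size (u : d.-tuple T) : size (word_pow u k) == (k * d)%N.
  by rewrite size_word_pow size_tuple.
pose pow u := Tuple (pow_size u).
have pow_inj : injective pow.
  move=> u v /(congr1 val) /=; rewrite -(prednK k_gt0) !word_powS => /eqP.
  by rewrite eqseq_cat ?size_tuple // => /andP[/eqP/val_inj].
rewrite -card_tuple -cardsT -(card_imset _ pow_inj); congr #|pred_of_set _|.
apply/setP=> w; rewrite inE -rot_eq_period //; apply/eqP/imsetP.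
  move=> /rot_fixed_word_pow-/(_ k); rewrite size_tuple => /(_ erefl) w_def.
  have sz : size (take d w) == d by rewrite size_takel ?size_tuple.
  by exists (Tuple sz); rewrite ?inE //; apply: val_inj.
by move=> [u _ ->] /=; rewrite -{1}(size_tuple u) rot_word_pow.
Qed.

(** Read each power [#|T| ^ d] as a number of words by [card_period_dvd], then
    exchange the two sums. *)
Lemma card_primitive (T : finType) (m : nat) : (0 < m)%N ->
  #|[set w : m.-tuple T | period w == m]|%:R =
    \sum_(d <- divisors m) moebius (m %/ d) * #|T|%:R ^+ d :> int.
Proof.
move=> m_gt0.
transitivity (\sum_(w : m.-tuple T) \sum_(d <- divisors m | (period w %| d)%N)
                moebius (m %/ d)).
  rewrite -sum1_card big_mkcond natr_sum; apply: eq_bigr => w _.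
  by rewrite sum_moebius_between ?period_dvd // inE; case: eqP.
rewrite (exchange_big_dep xpredT) //= big_seq [RHS]big_seq.
apply: eq_bigr => d; rewrite -dvdn_divisors // => dm.
rewrite -natrX -(card_period_dvd _ m_gt0 dm) mulr_natr -sumr_const.
by apply: eq_bigl => w; rewrite inE.
Qed.

(** * Lyndon words as least elements of rotation orbits *)

(** The conjugates of a word are its rotations, that is, its orbit. *)
Lemma lyndon_fconnect (disp : Order.disp_t) (T : finOrderType disp) (m : nat)
    (w : m.-tuple T) : (0 < m)%N ->
  lyndon w <-> period w = m /\
    forall v, fconnect (@rot1_tuple T m) w v ->
      ((w : seqlexi T) <= (v : seqlexi T))%O.
Proof.
move=> m_gt0; split=> -[/(primitive_period _ m_gt0) per_w w_min]; split=> // v.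
  move=> wv; apply: w_min; rewrite -(iter_findex wv).
  have le_m : (findex (@rot1_tuple T m) w v <= m)%N.
    by rewrite ltnW // -[ltnRHS]per_w findex_max.
  rewrite iter_rot1_tuple //; set k := findex _ _ _.
  by exists (take k w), (drop k w); rewrite cat_take_drop.
case=> x [y [w_def ->]].
have le_m : (size x <= m)%N by rewrite -(size_tuple w) w_def size_cat leq_addr.
rewrite -(rot_size_cat x y) -w_def -iter_rot1_tuple //.
by apply: w_min; apply: fconnect_iter.
Qed.

Definition lyndon_tuples (disp : Order.disp_t) (T : finOrderType disp)
    (m : nat) : {set m.-tuple T} := [set w : m.-tuple T | `[< lyndon w >]].

(** Rotating a Lyndon word [u] by [i < m] letters gives each primitive word once:
    [u] is recovered as the least element of the orbit, and [i] because the
    orbit has size [m]. *)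
Lemma card_lyndon (disp : Order.disp_t) (T : finOrderType disp) (m : nat) :
  (0 < m)%N ->
  (#|lyndon_tuples T m| * m)%N = #|[set w : m.-tuple T | period w == m]|.
Proof.
move=> m_gt0; pose f := @rot1_tuple T m.
have f_inj : injective f := @rot1_tuple_inj T m.
have f_sym := fconnect_sym f_inj.
pose h (p : m.-tuple T * 'I_m) := iter p.2 f p.1.
have per_eq u v : fconnect f u v -> period u = period v.
  by move=> uv; apply: eq_card; apply: same_connect.
rewrite -[X in (_ * X)%N]card_ord -[X in (_ * X)%N]cardsT -cardsX.
rewrite -(card_in_imset (f := h)); last first.
  (* Two Lyndon words in one orbit are both least in it, hence equal. *)
  move=> [u i] [v j]; rewrite !inE /= !andbT.
  move=> /asboolP/(lyndon_fconnect _ m_gt0)[per_u u_min].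
  move=> /asboolP/(lyndon_fconnect _ m_gt0)[per_v v_min].
  rewrite /h /= => eq_ij.
  have uv : fconnect f u v.
    by apply: connect_trans (fconnect_iter f i u) _; rewrite eq_ij f_sym fconnect_iter.
  have eq_uv : u = v.
    by apply/val_inj/(@le_anti _ (seqlexi T)); rewrite u_min // v_min // f_sym.
  subst v; congr (_, _); apply: val_inj => /=.
  have index_iter (k : 'I_m) : findex f u (iter k f u) = k.
    by apply: findex_iter; rewrite -[order f u]/(period u) per_u.
  by rewrite -(index_iter i) eq_ij index_iter.
congr #|pred_of_set _|; apply/setP=> w; rewrite !inE; apply/imsetP/eqP.
  case=> -[u i]; rewrite !inE andbT /= => /asboolP.
  move=> /(lyndon_fconnect _ m_gt0)[per_u _] ->.
  by rewrite -[RHS]per_u; apply/esym/per_eq/fconnect_iter.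
move=> per_w.
case: (@arg_minP _ (seqlexi T) _ w (fconnect f w) (fun v => v : seqlexi T)).
  exact: connect0.
move=> u wu u_min.
have uw : fconnect f u w by rewrite f_sym.
have lt_m : (findex f u w < m)%N.
  by rewrite -[ltnRHS]per_w (per_eq _ _ wu) findex_max.
exists (u, Ordinal lt_m); last by rewrite /h /= iter_findex.
rewrite !inE andbT; apply/asboolP/(lyndon_fconnect _ m_gt0).
split=> [|v uv]; first by rewrite -(per_eq _ _ wu).
by apply: u_min; apply: connect_trans uv.
Qed.

(** * Occurrences of Lyndon factors *)

(** The letters outside the factor, [a] before it and [b] after it, are free. *)
Lemma card_factor (T : finType) (a m b : nat) (Q : pred (seq T)) :
  #|[set w : (a + (m + b)).-tuple T | Q (take m (drop a w))]| =
  (#|[set y : m.-tuple T | Q y]| * #|T| ^ (a + b))%N.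
Proof.
pose h (p : a.-tuple T * m.-tuple T * b.-tuple T) :=
  [tuple of p.1.1 ++ [tuple of p.1.2 ++ p.2]].
have h_inj : injective h.
  move=> [[x y] z] [[x' y'] z'] /(congr1 val) /= /eqP.
  rewrite !eqseq_cat ?size_tuple //.
  by move=> /and3P[/eqP/val_inj-> /eqP/val_inj-> /eqP/val_inj->].
transitivity #|setX (setX [set: a.-tuple T] [set y : m.-tuple T | Q y])
                    [set: b.-tuple T]|; last first.
  by rewrite !cardsX !cardsT !card_tuple expnD mulnAC mulnC.
rewrite -(card_imset _ h_inj); congr #|pred_of_set _|.
apply/setP=> w; rewrite inE; apply/idP/imsetP => [Qw|[[[x y] z]]].
  have sx : size (take a w) == a by rewrite size_takel // size_tuple leq_addr.
  have sy : size (take m (drop a w)) == m.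
    by rewrite size_takel // size_drop size_tuple addKn leq_addr.
  have sz : size (drop m (drop a w)) == b.
    by rewrite !size_drop size_tuple !addKn.
  exists (Tuple sx, Tuple sy, Tuple sz); first by rewrite !inE Qw.
  by apply: val_inj; rewrite /= !cat_take_drop.
rewrite !inE andbT /= => Qy -> /=.
by rewrite drop_size_cat ?size_tuple // take_size_cat ?size_tuple.
Qed.

Lemma card_lyndon_occ (disp : Order.disp_t) (T : finOrderType disp)
    (n i m : nat) :
  #|[set w : n.-tuple T | `[< lyndon_occ w i m >]]| =
  (((1 <= m <= n) && (1 <= i <= n - m + 1)) *
     (#|lyndon_tuples T m| * #|T| ^ (n - m)))%N.
Proof.
case: (boolP (_ && _)) => [/andP[m_bnd i_bnd]|out]; last first.
  rewrite mul0n; apply/eqP; rewrite cards_eq0; apply/eqP/setP => w.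
  rewrite !inE; apply/asboolP => -[]; rewrite size_tuple => m_bnd i_bnd _.
  by rewrite m_bnd i_bnd in out.
rewrite mul1n.
(* [i] counts from 1, hence [i.-1] letters precede the factor. *)
have [a [b [-> n_def]]] : exists a b, i = a.+1 /\ n = (a + (m + b))%N.
  by exists i.-1, (n - m - i.-1)%N; lia.
subst n; rewrite (_ : a + (m + b) - m = a + b)%N; last by lia.
rewrite -(card_factor a m b (fun y : seq T => `[< lyndon y >])).
apply: eq_card => w; rewrite !inE /=; apply/asboolP/asboolP => [[]|w_lyn] //.
by split; rewrite ?size_tuple //; lia.
Qed.

Lemma sum_initial_interval (n c : nat) :
  (c <= n)%N -> (\sum_(i < n.+1) (1 <= i <= c) = c)%N.
Proof.
move=> le_cn; suff -> : (\sum_(i < n.+1) (1 <= i <= c) = minn n c)%N by lia.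
elim: n {le_cn} => [|n IHn]; first by rewrite big_ord1 /=; lia.
by rewrite big_ord_recr /= IHn; lia.
Qed.

Lemma total_lyndon_factors_sum (disp : Order.disp_t) (T : finOrderType disp)
    (n : nat) :
  (total_lyndon_factors T n =
   \sum_(w : n.-tuple T) \sum_(i < n.+1) \sum_(m < n.+1)
     `[< lyndon_occ w i m >])%N.
Proof.
rewrite /total_lyndon_factors cardsE -sum1_card big_mkcond /=.
rewrite (pair_bigA _ (fun (w : n.-tuple T) (i : 'I_n.+1) => \sum_(m < n.+1)
  `[< lyndon_occ w i m >])%N) /=.
rewrite (pair_bigA _ (fun (p : n.-tuple T * 'I_n.+1) (m : 'I_n.+1) =>
  `[< lyndon_occ p.1 p.2 m >] : nat)) /=.
by apply: eq_bigr => t _; rewrite unfold_in; case: asboolP.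
Qed.

Lemma sum_num_lyndon_factors (disp : Order.disp_t) (T : finOrderType disp)
    (n : nat) :
  (\sum_(w : n.-tuple T) num_lyndon_factors w = total_lyndon_factors T n)%N.
Proof.
rewrite total_lyndon_factors_sum; apply: eq_bigr => w _.
rewrite /num_lyndon_factors cardsE -sum1_card big_mkcond pair_bigA /=.
by apply: eq_bigr => p _; rewrite unfold_in; case: asboolP.
Qed.

(** There are [n - m + 1] starting positions for a factor of length [m], and by
    [card_lyndon_occ] each of them contributes the same number of words. *)
Lemma total_lyndon_factorsE (disp : Order.disp_t) (T : finOrderType disp)
    (n : nat) :
  total_lyndon_factors T n =
  (\sum_(1 <= m < n.+1)
     (n - m + 1) * (#|lyndon_tuples T m| * #|T| ^ (n - m)))%N.
Proof.
rewrite total_lyndon_factors_sum exchange_big /=.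
under eq_bigr do rewrite exchange_big /=.
rewrite exchange_big /= -(big_mkord xpredT (fun m => \sum_(i < n.+1)
  \sum_(w : n.-tuple T) `[< lyndon_occ w i m >])%N).
(* The term [m = 0] vanishes: occurrences have positive length. *)
rewrite big_ltn // big1 ?add0n => [|i _]; last first.
  by rewrite big1 // => w _; case: asboolP => // -[].
rewrite !big_nat; apply: eq_bigr => m m_bnd.
rewrite -[in RHS](@sum_initial_interval n (n - m + 1)); last by lia.
rewrite big_distrl /=; apply: eq_bigr => i _.
have := card_lyndon_occ T n i m; rewrite -ltnS m_bnd /= => <-.
rewrite -sum1_card [RHS]big_mkcond; apply: eq_bigr => w _.
by rewrite inE; case: asboolP.
Qed.

Theorem mainTheorem3 (sigma n : nat) (hsigma : (1 <= sigma)%N)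
    (hn : (1 <= n)%N) (disp : Order.disp_t) (T : finOrderType disp)
    (hT : #|T| = sigma) :
  (total_lyndon_factors T n)%:R =
    \sum_(1 <= m < n.+1)
      (n - m + 1)%:R / m%:R * sigma%:R ^+ (n - m) *
      (\sum_(d <- divisors m) (moebius (m %/ d))%:~R * sigma%:R ^+ d) :> rat
  /\ expected_lyndon_factors T n
     = (total_lyndon_factors T n)%:R / sigma%:R ^+ n.
Proof.
split; last first.
  rewrite /expected_lyndon_factors /uniform_expectation -mulr_sumr mulrC.
  by rewrite -natr_sum sum_num_lyndon_factors card_tuple hT natrX.
rewrite total_lyndon_factorsE natr_sum !big_nat; apply: eq_bigr => m.
case/andP=> m_gt0 _.
have -> : \sum_(d <- divisors m) (moebius (m %/ d))%:~R * sigma%:R ^+ d =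
    #|lyndon_tuples T m|%:R * m%:R :> rat.
  rewrite -natrM card_lyndon // -[RHS]mulrz_nat card_primitive // hT rmorph_sum.
  by apply: eq_bigr => d _; rewrite rmorphM rmorphXn /= mulrz_nat.
have m_neq0 : m%:R != 0 :> rat by rewrite pnatr_eq0 -lt0n.
by rewrite !natrM natrX hT; field.
Qed.
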